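(* Let $(X,\mathcal A)$ be a measurable space, $\bar y\in(0,\infty]$, $k\in(0,\bar y]$, let $\vartriangle\colon m(\mathcal A)\times m(\mathcal A)\to m(\mathcal A)$, and let $m\in\mathcal M_{(X,\mathcal A)}$ be such that $m(C\cap D)\ge m(C)\vartriangle m(D)$ for all $C,D\in\mathcal A$. Let $\varphi_i\colon[0,\bar y]\to[0,\bar y]$ be increasing and right-continuous, and $\psi_i\colon[0,\varphi_i(\bar y)]\to[0,\bar y]$ be non-decreasing and left-continuous for $i=1,2,3$. Suppose that $\star\colon[0,\bar y]^2\to[0,\bar y]$ is a non-decreasing and left-continuous fusion function, and $\circ_i\colon[0,\bar y]\times m(\mathcal A)\to[0,\bar y]$ are non-decreasing such that $\varphi_i(\bar y)\circ_i m(X)\le\varphi_i(\bar y)$ for $i=1,2,3$ and $\bar y\circ_j0=0$ for $j=2,3$. If $$\psi_1\big(\varphi_1(a\star b)\circ_1(c\vartriangle d)\big)\ge\psi_2\big(\varphi_2(a)\circ_2 c\big)\star\psi_3\big(\varphi_3(b)\circ_3 d\big)$$ holds for all $a,b\in[0,k]$ and $c,d\in m(\mathcal A)$, then the Chebyshev type inequality $$\psi_1\big(\mathbf I_{\circ_1,A\cap B}(m,\varphi_1(f\star g))\big)\ge\psi_2\big(\mathbf I_{\circ_2,A}(m,\varphi_2(f))\big)\star\psi_3\big(\mathbf I_{\circ_3,B}(m,\varphi_3(g))\big)$$ is satisfied for all functions $f,g\in\mathcal F^{k}_{(X,\mathcal A)}$ and all $A,B\in\mathcal A$.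
   Context: $(X,\mathcal A)$ is a measurable space ($X$ non-empty, $\mathcal A$ a $\sigma$-algebra). $\mathcal F^{k}_{(X,\mathcal A)}$ is the set of all $\mathcal A$-measurable functions $f\colon X\to[0,k]$. $\mathcal M_{(X,\mathcal A)}$ is the set of monotone measures: set functions $m\colon\mathcal A\to[0,\infty]$ with $m(A)\le m(B)$ whenever $A\subset B$, $m(\emptyset)=0$, $m(X)>0$. $m(\mathcal A)=\{m(A):A\in\mathcal A\}$ is the range of $m$. A fusion function is a binary operation $[0,\bar y]^2\to[0,\bar y]$. A function $\circ\colon Y_1\times Y_2\to[0,\infty]$ is non-decreasing if $a_1\circ a_2\le b_1\circ b_2$ whenever $a_i\le b_i$, $a_i,b_i\in Y_i$. A non-decreasing fusion function is left-continuous if it is left-continuous in each coordinate. ''Increasing'' (for functions of one variable) means strictly increasing. $f\star g$ is the pointwise operation $x\mapsto f(x)\star g(x)$, and $\varphi(f)=\varphi\circ f$ is the composition. Generalized (upper) Sugeno integral: for $D\in\mathcal A$, a measurable $f\colon X\to[0,\bar y]$ and a non-decreasing $\circ$, $$\mathbf I_{\circ,D}(m,f)=\sup_{t\in[0,\bar y]}\{t\circ m(D\cap\{f\ge t\})\},\qquad \{f\ge t\}=\{x\in X: f(x)\ge t\}.$$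
   Formalization: The inequality is proved for those f, g, A, B for which the integral I_{∘₁,A∩B}(m,φ₁(f⋆g)) is at most φ₁(ȳ); otherwise it lies outside the domain [0,φ₁(ȳ)] of ψ₁ and the left-hand side is undefined (e.g. a∘₁c=a with φ₁(ȳ)<ȳ). *)

(* Defs.v *)
From HB Require Import structures.
From mathcomp Require Import all_boot all_order all_algebra.
From mathcomp Require Import all_classical all_reals all_analysis.
From mathcomp Require Import measurable_realfun.

Set Implicit Arguments.
Unset Strict Implicit.
Unset Printing Implicit Defensive.

Import Order.TTheory GRing.Theory Num.Theory.
Import numFieldNormedType.Exports.

Local Open Scope classical_set_scope.
Local Open Scope ring_scope.
Local Open Scope ereal_scope.

(* Functions with a restricted domain, such as [0, y] -> [0, y] or
   [0, y] x m(A) -> [0, y], are represented by total functions on \bar R;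
   every hypothesis about them is relativized to the intended domain, so their
   values elsewhere are arbitrary. *)

Section RealFunctions.
Context {R : realType}.

(* The closed interval [0, y]; y = +oo is allowed, and [0, +oo] contains +oo. *)
Definition seg0 (y : \bar R) : set (\bar R) := [set x | 0 <= x <= y].

Definition nondecreasing_on (D : set (\bar R)) (f : \bar R -> \bar R) : Prop :=
  forall x z, D x -> D z -> x <= z -> f x <= f z.

Definition increasing_on (D : set (\bar R)) (f : \bar R -> \bar R) : Prop :=
  forall x z, D x -> D z -> x < z -> f x < f z.

(* One-sided continuity relative to D: the limit is taken along points of D
   only, and is vacuous where D has no point on the relevant side. *)
Definition left_continuous_on (D : set (\bar R)) (f : \bar R -> \bar R) : Prop :=
  forall x, D x -> f @ within (D `&` [set u | u < x]) (nbhs x) --> f x.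

Definition right_continuous_on (D : set (\bar R)) (f : \bar R -> \bar R) : Prop :=
  forall x, D x -> f @ within (D `&` [set u | x < u]) (nbhs x) --> f x.

Definition maps2 (Y1 Y2 Y : set (\bar R)) (op : \bar R -> \bar R -> \bar R) :
    Prop :=
  forall a b, Y1 a -> Y2 b -> Y (op a b).

Definition nondecreasing2_on (Y1 Y2 : set (\bar R))
    (op : \bar R -> \bar R -> \bar R) : Prop :=
  forall a1 a2 b1 b2, Y1 a1 -> Y2 a2 -> Y1 b1 -> Y2 b2 ->
    a1 <= b1 -> a2 <= b2 -> op a1 a2 <= op b1 b2.

Definition fusion_function (y : \bar R) (op : \bar R -> \bar R -> \bar R) :
    Prop :=
  maps2 (seg0 y) (seg0 y) (seg0 y) op.

Definition left_continuous2_on (Y1 Y2 : set (\bar R))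
    (op : \bar R -> \bar R -> \bar R) : Prop :=
  (forall b, Y2 b -> left_continuous_on Y1 (fun a => op a b)) /\
  (forall a, Y1 a -> left_continuous_on Y2 (fun b => op a b)).

End RealFunctions.

Section MonotoneMeasures.
Context {d : measure_display} {X : measurableType d} {R : realType}.
Implicit Types (m : set X -> \bar R) (f : X -> \bar R).

(* A set function on the sigma-algebra is represented by a function on
   [set X] of which only the values at measurable sets are used. *)
Definition monotone_measure m : Prop :=
  [/\ forall A, measurable A -> 0 <= m A,
      forall A B, measurable A -> measurable B -> A `<=` B -> m A <= m B,
      m set0 = 0
    & 0 < m setT].

Definition mrange m : set (\bar R) :=
  [set m A | A in (measurable : set (set X))].

Definition bounded_measurable (k : \bar R) f : Prop :=
  measurable_fun setT f /\ (forall x, seg0 k (f x)).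

Definition upper_sugeno (y : \bar R) (op : \bar R -> \bar R -> \bar R)
    (D : set X) m f : \bar R :=
  ereal_sup [set op t (m (D `&` [set x | t <= f x])) | t in seg0 y].

End MonotoneMeasures.

(* Main.v *)
(* For [a, b] in [0, k], the compatibility inequality applied to the level sets
   [A & {f >= a}] and [B & {g >= b}] bounds
   [psi2 (phi2 a o2 m (A & {f >= a})) * psi3 (phi3 b o3 m (B & {g >= b}))] by
   [psi1] of the left-hand integral, because the intersection of these sets lies
   in [A & B & {phi1 (f * g) >= phi1 (a * b)}]. Right-continuity of [phi_i]
   shows that each value of which the integral of [phi2 f] or [phi3 g] is the
   supremum is dominated by one of this form, and left-continuity of [psi2],
   [psi3] and [*] lets the inequality pass to the two suprema. *)
Require Import Defs.
From HB Require Import structures.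
From mathcomp Require Import all_boot all_order all_algebra.
From mathcomp Require Import all_classical all_reals all_analysis.
From mathcomp Require Import measurable_realfun.

Set Implicit Arguments.
Unset Strict Implicit.

Import Order.TTheory GRing.Theory Num.Theory.
Import numFieldNormedType.Exports.

Local Open Scope classical_set_scope.
Local Open Scope ring_scope.
Local Open Scope ereal_scope.

(** * One-sided continuity and the passage of bounds to suprema and infima *)

Lemma seq_cvg_within (T U : topologicalType) (D : set T) (F : T -> U)
    (u : nat -> T) (x : T) (l : U) :
  F @ within D (nbhs x) --> l -> (forall i, D (u i)) -> u @ \oo --> x ->
  F (u i) @[i --> \oo] --> l.
Proof.
move=> Fl Du ux P Pl; have /Fl := Pl.
rewrite /nbhs /= /within /= => /ux; rewrite /nbhs /=.
by apply: filterS => i; apply.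
Qed.

Section OneSidedContinuity.
Context {R : realType}.
Implicit Types (D S : set (\bar R)) (F G : \bar R -> \bar R) (b x y L : \bar R).

Lemma increasing_on_nondecreasing D F :
  increasing_on D F -> nondecreasing_on D F.
Proof.
by move=> inc x z Dx Dz; rewrite le_eqVlt => /predU1P[->//|xz]; exact/ltW/inc.
Qed.

(** If [S] attains its supremum, the bound there is one of the assumed ones. Otherwise a sequence in
    [S] tending to the supremum stays strictly below it, so left-continuity applies along it. *)
Lemma left_continuous_sup_le D F S L : left_continuous_on D F ->
  S `<=` D -> S !=set0 -> D (ereal_sup S) -> (forall s, S s -> F s <= L) ->
  F (ereal_sup S) <= L.
Proof.
move=> lcF SD S0 DS FL.
have [|nS] := pselect (S (ereal_sup S)); first exact: FL.
have [u uS ucvg] := ereal_sup_seq ((set0P S).2 S0).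
have uD i : (D `&` [set v | v < ereal_sup S]) (u i).
  split; first exact: SD.
  rewrite /= lt_neqAle ereal_sup_ubound// andbT.
  by apply/eqP => e; apply: nS; rewrite -e.
have Fu := seq_cvg_within (lcF _ DS) uD ucvg.
apply: (cvge_to_le Fu).
by apply: nearW => i; apply: FL.
Qed.

Lemma right_continuous_inf_ge D F S L : right_continuous_on D F ->
  S `<=` D -> S !=set0 -> D (ereal_inf S) -> (forall s, S s -> L <= F s) ->
  L <= F (ereal_inf S).
Proof.
move=> rcF SD S0 DS FL.
have [|nS] := pselect (S (ereal_inf S)); first exact: FL.
have [u uS ucvg] := ereal_inf_seq ((set0P S).2 S0).
have uD i : (D `&` [set v | ereal_inf S < v]) (u i).
  split; first exact: SD.
  rewrite /= lt_neqAle ereal_inf_lbound// andbT.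
  by apply/eqP => e; apply: nS; rewrite e.
have Fu := seq_cvg_within (rcF _ DS) uD ucvg.
apply: (cvge_to_ge Fu).
by apply: nearW => i; apply: FL.
Qed.

(** [G] may be constant just below the supremum, so its values need not approach the limit strictly
    from below. The bound therefore passes through two suprema: [G] commutes with the one of [S],
    and [F] is then treated at the one of the image. *)
Lemma left_continuous_comp_sup_le D D' F G S L :
  set_fun D D' G -> nondecreasing_on D G -> left_continuous_on D G ->
  left_continuous_on D' F ->
  S `<=` D -> S !=set0 -> D (ereal_sup S) ->
  (forall s, S s -> F (G s) <= L) -> F (G (ereal_sup S)) <= L.
Proof.
move=> DG ndG lcG lcF SD [s0 Ss0] DS FGL.
have supG : G (ereal_sup S) = ereal_sup (G @` S).
  apply/eqP; rewrite eq_le; apply/andP; split.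
    apply: (left_continuous_sup_le lcG) => //; first by exists s0.
    by move=> s Ss; apply: ereal_sup_ubound; exists s.
  apply: ge_ereal_sup => _ [s Ss <-].
  by apply: ndG => //; [exact: SD | exact: ereal_sup_ubound].
rewrite supG; apply: (left_continuous_sup_le lcF).
- by move=> _ [s /SD Ds <-]; exact: DG.
- by exists (G s0), s0.
- by rewrite -supG; exact: DG.
- by move=> _ [s Ss <-]; exact: FGL.
Qed.

Lemma seg0_rat_sup x : 0 <= x ->
  ereal_sup [set z | exists2 q : rat, z = (ratr q)%:E & seg0 x z] = x.
Proof.
move=> x0; set S := [set z | _].
have Sx : ereal_sup S <= x by apply: ge_ereal_sup => z [q _ /andP[]].
have S0 : 0 <= ereal_sup S.
  apply: ereal_sup_ubound; exists 0%R; first by rewrite rmorph0.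
  by rewrite /seg0 /= lexx.
move: Sx; rewrite le_eqVlt => /predU1P[//|Sx].
have Sfin : ereal_sup S \is a fin_num.
  by rewrite ge0_fin_numE// (lt_le_trans Sx)// leey.
pose r := fine (ereal_sup S); have rS : ereal_sup S = r%:E by rewrite fineK.
(* [s] is a real stand-in for [x], which may be [+oo]; a rational strictly between [r] and [s] then
   contradicts [r] being the supremum. *)
have [s [rs sx]] : exists s : R, (r < s)%R /\ s%:E <= x.
  move: Sx; rewrite rS; case: (x) => [z| |] //.
    by rewrite lte_fin => rz; exists z.
  by exists (r + 1)%R; rewrite ltrDl leey.
have [q] := rat_in_itvoo rs; rewrite in_itv /= => /andP[rq qs].
suff : (ratr q)%:E <= r%:E by rewrite lee_fin leNgt rq.
rewrite -rS; apply: ereal_sup_ubound; exists q => //; apply/andP; split.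
  by rewrite (le_trans S0)// rS lee_fin ltW.
by apply: le_trans sx; rewrite lee_fin ltW.
Qed.

(** Contrapositive: a bound [F <= b] at all rationals of [[0, x]] passes to their supremum, which is
    [x]. *)
Lemma left_continuous_rat y F x b : left_continuous_on (seg0 y) F ->
  seg0 y x -> b < F x ->
  exists2 q : rat, seg0 x (ratr q)%:E & b < F (ratr q)%:E.
Proof.
move=> lcF /andP[x0 xy]; apply: contraPP => /forall2NP nq; apply/negP.
rewrite -leNgt -(seg0_rat_sup x0).
apply: (left_continuous_sup_le lcF).
- by move=> z [q _ /andP[z0 zx]]; rewrite /seg0 /= z0 (le_trans zx).
- by exists 0, 0%R; [rewrite rmorph0 | rewrite /seg0 /= lexx].
- by rewrite seg0_rat_sup// /seg0 /= x0.
- by move=> _ [q -> xq]; case: (nq q) => // /negP; rewrite leNgt.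
Qed.

End OneSidedContinuity.

(** * Measurability of the combined function and level sets of [phi (f x)] *)

Section Integral.
Context {d : measure_display} {X : measurableType d} {R : realType}.
Implicit Types (f g : X -> \bar R) (op star : \bar R -> \bar R -> \bar R).

(* A left-continuous non-decreasing operation that exceeds [t] at [(a, b)]
   already does so at some rational point below [(a, b)], so its superlevel
   sets are countable unions of quadrants. *)
Lemma measurable_fun_star (y : \bar R) star f g :
  nondecreasing2_on (seg0 y) (seg0 y) star ->
  left_continuous2_on (seg0 y) (seg0 y) star ->
  bounded_measurable y f -> bounded_measurable y g ->
  measurable_fun setT (fun x => star (f x) (g x)).
Proof.
move=> nd [lc1 lc2] [mf fy] [mg gy].
apply: (measurability _ (ErealGenOInfty.measurableE R)).
move=> /= _ [_ [r ->]] <-; rewrite setTI preimage_itvoy.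
(* Pairs failing [Q] contribute the empty set, so both unions run over all rationals. *)
pose Q (p q : rat) := `[< [/\ seg0 y (ratr p)%:E, seg0 y (ratr q)%:E &
  r%:E < star (ratr p)%:E (ratr q)%:E] >].
rewrite [X in measurable X](_ : _ = \bigcup_p \bigcup_q
  (if Q p q then [set x | (ratr p)%:E <= f x] `&` [set x | (ratr q)%:E <= g x]
   else set0)); last first.
  apply/seteqP; split => [x /= rx|x [p _ [q _]]]; last first.
    case: ifPn => // /asboolP[Hp Hq rpq] [/= pf qg].
    exact: (lt_le_trans rpq (nd _ _ _ _ _ _ _ _ pf qg)).
  (* Continuity is only separate, so the coordinates are made rational in turn: [p] with [g x]
     fixed, then [q] with [p] fixed. *)
  have [p /andP[p0 pf] rp] := left_continuous_rat (lc1 _ (gy x)) (fy x) rx.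
  have yp : seg0 y (ratr p)%:E.
    by have /andP[_ fxy] := fy x; rewrite /seg0 /= p0 (le_trans pf).
  have [q /andP[q0 qg] rq] := left_continuous_rat (lc2 _ yp) (gy x) rp.
  have yq : seg0 y (ratr q)%:E.
    by have /andP[_ gxy] := gy x; rewrite /seg0 /= q0 (le_trans qg).
  by exists p => //; exists q => //; have -> : Q p q by exact/asboolP.
apply: bigcupT_measurable_rat => p; apply: bigcupT_measurable_rat => q.
case: ifP => // _; apply: measurableI.
  by rewrite -[X in measurable X]setTI; exact: emeasurable_fun_c_infty.
by rewrite -[X in measurable X]setTI; exact: emeasurable_fun_c_infty.
Qed.

(* By right-continuity of [phi], [phi (f x) >= t] is the same as [f x >= a] for
   the least [a] with [phi a >= t]; if there is no such [a], the level set is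
   empty and the value is [0]. *)
Lemma upper_sugeno_value_le (y k : \bar R) (m : set X -> \bar R)
    (phi : \bar R -> \bar R) op (A : set X) f (t : \bar R) :
  0 < k -> k <= y -> monotone_measure m ->
  set_fun (seg0 y) (seg0 y) phi -> increasing_on (seg0 y) phi ->
  right_continuous_on (seg0 y) phi ->
  maps2 (seg0 y) (mrange m) (seg0 y) op ->
  nondecreasing2_on (seg0 y) (mrange m) op -> op y 0 = 0 ->
  bounded_measurable k f -> measurable A -> seg0 y t ->
  0 <= op t (m (A `&` [set x | t <= phi (f x)])) /\
  exists2 a, seg0 k a & op t (m (A `&` [set x | t <= phi (f x)])) <=
                        op (phi a) (m (A `&` [set x | a <= f x])).
Proof.
move=> k0 ky [_ _ m_0 _] phiy inc rc opm opnd opy0 [mf fk] mA ty.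
have ky' z : seg0 k z -> seg0 y z.
  by rewrite /seg0 /= => /andP[-> zk]; rewrite (le_trans zk).
have nd := increasing_on_nondecreasing inc.
have mfa a : measurable (A `&` [set x | a <= f x]).
  exact: emeasurable_fun_c_infty (measurable_funTS mf) a.
have k00 : seg0 k 0 by rewrite /seg0 /= lexx ltW.
have kk : seg0 k k by rewrite /seg0 /= lexx ltW.
have yy : seg0 y y by rewrite /seg0 /= lexx (le_trans (ltW k0)).
pose S := [set u | seg0 k u /\ t <= phi u].
have op_ge0 u E : seg0 y u -> measurable E -> 0 <= op u (m E).
  by move=> yu mE; have /andP[] := opm _ _ yu (imageP m mE : mrange m _).
have [tk|kt] := leP t (phi k); last first.
  have -> : A `&` [set x | t <= phi (f x)] = set0.
    rewrite -subset0 => x [_ /= tf]; move: kt; apply/negP; rewrite -leNgt.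
    apply: le_trans tf _; apply: nd; [exact/ky'|exact/ky'|].
    by have /andP[] := fk x.
  split; first exact: op_ge0.
  (* Any [a] in [[0, k]] would do, since [op t 0 <= op y 0 = 0]. *)
  exists 0 => //; apply: (@le_trans _ _ 0); last exact/op_ge0/mfa/phiy/ky'.
  rewrite -[leRHS]opy0 m_0; have r0 : mrange m 0 by exists set0.
  by apply: opnd => //; have /andP[] := ty.
have Sk : S k by [].
pose a := ereal_inf S.
have ka : seg0 k a.
  apply/andP; split; last exact: ereal_inf_lbound.
  by apply: le_ereal_inf_tmp => u [/andP[]].
(* Right-continuity makes the infimum [a] itself a point of [S]. *)
have ta : t <= phi a.
  apply: (right_continuous_inf_ge rc).
  - by move=> u [/ky'].
  - by exists k.
  - exact/ky'.
  - by move=> s [].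
have -> : [set x | t <= phi (f x)] = [set x | a <= f x].
  apply/seteqP; split => x /=.
    by move=> tf; apply: ereal_inf_lbound.
  by move=> af; apply: le_trans ta _; apply: nd => //; exact: ky'.
split; first exact: op_ge0.
exists a => //; apply: opnd => //; [exact/imageP|exact/phiy/ky'|exact/imageP].
Qed.

End Integral.

(** * The Chebyshev type inequality, from level sets to integrals *)

Unset Implicit Arguments.

(* The integral of phi1 (f * g) may exceed phi1 y (through values t o1 0 with
   t > phi1 y), where psi1 is undefined; the last premise says that the
   left-hand side of the conclusion is defined. The arguments of psi2 and psi3
   always lie in their domains. *)
Theorem theorem5p1 (R : realType) (d : measure_display) (X : measurableType d)
  (y k : \bar R) (y_gt0 : 0 < y) (k_gt0 : 0 < k) (k_le_y : k <= y)
  (m : set X -> \bar R) (m_mon : monotone_measure m)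
  (tri : \bar R -> \bar R -> \bar R)
  (tri_maps : maps2 (mrange m) (mrange m) (mrange m) tri)
  (m_tri : forall C D : set X, measurable C -> measurable D ->
     tri (m C) (m D) <= m (C `&` D))
  (phi1 phi2 phi3 : \bar R -> \bar R)
  (phi1_maps : set_fun (seg0 y) (seg0 y) phi1)
  (phi2_maps : set_fun (seg0 y) (seg0 y) phi2)
  (phi3_maps : set_fun (seg0 y) (seg0 y) phi3)
  (phi1_inc : increasing_on (seg0 y) phi1)
  (phi2_inc : increasing_on (seg0 y) phi2)
  (phi3_inc : increasing_on (seg0 y) phi3)
  (phi1_rc : right_continuous_on (seg0 y) phi1)
  (phi2_rc : right_continuous_on (seg0 y) phi2)
  (phi3_rc : right_continuous_on (seg0 y) phi3)
  (psi1 psi2 psi3 : \bar R -> \bar R)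
  (psi1_maps : set_fun (seg0 (phi1 y)) (seg0 y) psi1)
  (psi2_maps : set_fun (seg0 (phi2 y)) (seg0 y) psi2)
  (psi3_maps : set_fun (seg0 (phi3 y)) (seg0 y) psi3)
  (psi1_nd : nondecreasing_on (seg0 (phi1 y)) psi1)
  (psi2_nd : nondecreasing_on (seg0 (phi2 y)) psi2)
  (psi3_nd : nondecreasing_on (seg0 (phi3 y)) psi3)
  (psi1_lc : left_continuous_on (seg0 (phi1 y)) psi1)
  (psi2_lc : left_continuous_on (seg0 (phi2 y)) psi2)
  (psi3_lc : left_continuous_on (seg0 (phi3 y)) psi3)
  (star : \bar R -> \bar R -> \bar R)
  (star_fusion : fusion_function y star)
  (star_nd : nondecreasing2_on (seg0 y) (seg0 y) star)
  (star_lc : left_continuous2_on (seg0 y) (seg0 y) star)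
  (op1 op2 op3 : \bar R -> \bar R -> \bar R)
  (op1_maps : maps2 (seg0 y) (mrange m) (seg0 y) op1)
  (op2_maps : maps2 (seg0 y) (mrange m) (seg0 y) op2)
  (op3_maps : maps2 (seg0 y) (mrange m) (seg0 y) op3)
  (op1_nd : nondecreasing2_on (seg0 y) (mrange m) op1)
  (op2_nd : nondecreasing2_on (seg0 y) (mrange m) op2)
  (op3_nd : nondecreasing2_on (seg0 y) (mrange m) op3)
  (op1_le : op1 (phi1 y) (m setT) <= phi1 y)
  (op2_le : op2 (phi2 y) (m setT) <= phi2 y)
  (op3_le : op3 (phi3 y) (m setT) <= phi3 y)
  (op2_y0 : op2 y 0 = 0) (op3_y0 : op3 y 0 = 0)
  (compat : forall a b c e : \bar R,
     seg0 k a -> seg0 k b -> mrange m c -> mrange m e ->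
     star (psi2 (op2 (phi2 a) c)) (psi3 (op3 (phi3 b) e)) <=
     psi1 (op1 (phi1 (star a b)) (tri c e))) :
  forall (f g : X -> \bar R) (A B : set X),
    bounded_measurable k f -> bounded_measurable k g ->
    measurable A -> measurable B ->
    upper_sugeno y op1 (A `&` B) m (fun x => phi1 (star (f x) (g x)))
      <= phi1 y ->
    star (psi2 (upper_sugeno y op2 A m (phi2 \o f)))
         (psi3 (upper_sugeno y op3 B m (phi3 \o g))) <=
    psi1 (upper_sugeno y op1 (A `&` B) m
            (fun x => phi1 (star (f x) (g x)))).
Proof.
move=> f g A B bf bg mA mB I1y.
have [_ mm _ _] := m_mon.
have ky z : seg0 k z -> seg0 y z.
  by rewrite /seg0 /= => /andP[-> zk]; rewrite (le_trans zk).
have yy : seg0 y y by rewrite /seg0 /= lexx ltW.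
have phi1_nd := increasing_on_nondecreasing phi1_inc.
have mle (E : set X) h a : measurable E -> bounded_measurable k h ->
    measurable (E `&` [set x | a <= h x]).
  by move=> mE [mh _]; exact: emeasurable_fun_c_infty (measurable_funTS mh) a.
have bounded (h : X -> \bar R) :
    bounded_measurable k h -> bounded_measurable y h.
  by move=> [mh hk]; split => // x; exact: ky.
(* These values are at most [op (phi y) (m setT) <= phi y], hence lie where the corresponding [psi]
   is defined. *)
have op_seg phi op a E : set_fun (seg0 y) (seg0 y) phi ->
    increasing_on (seg0 y) phi -> maps2 (seg0 y) (mrange m) (seg0 y) op ->
    nondecreasing2_on (seg0 y) (mrange m) op ->
    op (phi y) (m setT) <= phi y -> seg0 y a -> measurable E ->
    seg0 (phi y) (op (phi a) (m E)).
  move=> phiy inc opm opnd ople ya mE.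
  have mT : mrange m (m setT) by exact/imageP.
  have mE' : mrange m (m E) by exact/imageP.
  apply/andP; split; first by have /andP[] := opm _ _ (phiy _ ya) mE'.
  apply: le_trans ople; apply: opnd => //; [exact: phiy|exact: phiy| |].
    by apply: (increasing_on_nondecreasing inc) => //; have /andP[] := ya.
  exact: mm.
have sup_seg (Y : \bar R) (S : set (\bar R)) : S `<=` seg0 Y -> S !=set0 ->
    seg0 Y (ereal_sup S).
  move=> SY [s Ss]; apply/andP; split; last first.
    by apply: ge_ereal_sup => z /SY /andP[].
  have /andP[s0 _] := SY _ Ss.
  exact/(le_trans s0)/ereal_sup_ubound.
have basic a b : seg0 k a -> seg0 k b ->
    star (psi2 (op2 (phi2 a) (m (A `&` [set x | a <= f x]))))
         (psi3 (op3 (phi3 b) (m (B `&` [set x | b <= g x])))) <=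
    psi1 (upper_sugeno y op1 (A `&` B) m (fun x => phi1 (star (f x) (g x)))).
  move=> ka kb; have mAf := mle _ _ a mA bf; have mBg := mle _ _ b mB bg.
  have yab : seg0 y (star a b) by apply: star_fusion; exact: ky.
  have yfg x : seg0 y (star (f x) (g x)).
    by apply: star_fusion; apply: ky; [have [] := bf | have [] := bg].
  pose E := A `&` B `&` [set x | phi1 (star a b) <= phi1 (star (f x) (g x))].
  have mE : measurable E.
    (* A strictly increasing [phi1] reflects the order, so the level set is one of
       [star (f x) (g x)], which is measurable. *)
    rewrite /E (_ : [set x | _] = [set x | star a b <= star (f x) (g x)]).
      apply: emeasurable_fun_c_infty; first exact: measurableI.
      apply: measurable_funTS.
      exact: measurable_fun_star star_nd star_lc (bounded _ bf) (bounded _ bg).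
    apply/seteqP; split => x /=; last exact: phi1_nd.
    by rewrite leNgt => p; rewrite leNgt; apply: contra p; exact: phi1_inc.
  apply: (le_trans (compat _ _ _ _ ka kb (imageP m mAf : mrange m _)
    (imageP m mBg : mrange m _))).
  have tri_le : tri (m (A `&` [set x | a <= f x]))
                    (m (B `&` [set x | b <= g x])) <= m E.
    apply: (le_trans (m_tri _ _ mAf mBg)); apply: mm => //.
      exact: measurableI.
    move=> x [[Ax /= af] [Bx /= bgx]]; split => //=.
    apply: phi1_nd => //; apply: star_nd => //; apply: ky => //.
      by have [] := bf.
    by have [] := bg.
  have opE : op1 (phi1 (star a b)) (m E) <=
      upper_sugeno y op1 (A `&` B) m (fun x => phi1 (star (f x) (g x))).
    by apply: ereal_sup_ubound; exists (phi1 (star a b)) => //;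
      exact: phi1_maps.
  have rtri : mrange m (tri (m (A `&` [set x | a <= f x]))
                    (m (B `&` [set x | b <= g x]))).
    by apply: tri_maps; exact/imageP.
  have opt : op1 (phi1 (star a b)) (tri (m (A `&` [set x | a <= f x]))
                    (m (B `&` [set x | b <= g x]))) <=
             op1 (phi1 (star a b)) (m E).
    apply: op1_nd => //; [exact: phi1_maps|exact: phi1_maps|exact/imageP].
  have t0 := op1_maps _ _ (phi1_maps _ yab) rtri.
  have {}opE := le_trans opt opE.
  (* [psi1] is monotone only on [[0, phi1 y]]; the premise [I1y] puts both arguments there. *)
  apply: psi1_nd => //; apply/andP; split => //.
  - by have /andP[] := t0.
  - exact: le_trans opE I1y.
  - by have /andP[s0 _] := t0; exact: le_trans opE.
have seg_val phi op h E : set_fun (seg0 y) (seg0 y) phi ->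
    increasing_on (seg0 y) phi -> right_continuous_on (seg0 y) phi ->
    maps2 (seg0 y) (mrange m) (seg0 y) op ->
    nondecreasing2_on (seg0 y) (mrange m) op ->
    op (phi y) (m setT) <= phi y -> op y 0 = 0 ->
    bounded_measurable k h -> measurable E ->
    forall s, [set op t (m (E `&` [set x | t <= (phi \o h) x]))
                | t in seg0 y] s ->
    seg0 (phi y) s /\ exists2 a, seg0 k a &
      s <= op (phi a) (m (E `&` [set x | a <= h x])).
  move=> phiy inc rc opm opnd ople op0 bh mE _ [t ty <-].
  have [ge0 [a ka le_a]] :=
    upper_sugeno_value_le k_gt0 k_le_y m_mon phiy inc rc opm opnd op0 bh mE ty.
  split; last by exists a.
  apply/andP; split=> //; apply: le_trans le_a _.
  by have /andP[] := op_seg _ _ a _ phiy inc opm opnd ople (ky _ ka)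
    (mle _ _ a mE bh).
have seg2 := seg_val _ _ _ _ phi2_maps phi2_inc phi2_rc op2_maps op2_nd op2_le
  op2_y0 bf mA.
have seg3 := seg_val _ _ _ _ phi3_maps phi3_inc phi3_rc op3_maps op3_nd op3_le
  op3_y0 bg mB.
have [lc1 lc2] := star_lc.
have ne (op : \bar R -> \bar R -> \bar R) E (h : X -> \bar R) :
    [set op t (m (E `&` [set x | t <= h x])) | t in seg0 y] !=set0.
  by eexists; exists y.
have sub2 := fun s Ss => (seg2 s Ss).1; have sub3 := fun s Ss => (seg3 s Ss).1.
have sup2 := sup_seg _ _ sub2 (ne _ _ _).
have sup3 := sup_seg _ _ sub3 (ne _ _ _).
rewrite {1}/upper_sugeno.
(* The suprema are removed one coordinate at a time: first that of [f], with the whole integral of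
   [phi3 \o g] kept in the second slot, then that of [g], with the value [s] fixed in the first. *)
apply: (left_continuous_comp_sup_le (D := seg0 (phi2 y)) (D' := seg0 y)
  (F := fun a => star a _)) => //; first exact/lc1/psi3_maps.
move=> s /[dup] /sub2 s2 /seg2[_ [a ka sa]].
rewrite [upper_sugeno y op3 _ _ _]/upper_sugeno.
apply: (left_continuous_comp_sup_le (D := seg0 (phi3 y)) (D' := seg0 y)
  (F := fun b => star (psi2 s) b)) => //; first exact/lc2/psi2_maps.
move=> r /[dup] /sub3 r3 /seg3[_ [b kb rb]].
apply: le_trans (basic _ _ ka kb).
(* The dominating values must lie in the domains of [psi2] and [psi3] before monotonicity can
   compare them with [s] and [r]. *)
have va := op_seg _ _ a _ phi2_maps phi2_inc op2_maps op2_nd op2_le (ky _ ka)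
  (mle _ _ a mA bf).
have vb := op_seg _ _ b _ phi3_maps phi3_inc op3_maps op3_nd op3_le (ky _ kb)
  (mle _ _ b mB bg).
by apply: star_nd; [exact: psi2_maps|exact: psi3_maps|exact: psi2_maps|
  exact: psi3_maps|exact: psi2_nd|exact: psi3_nd].
Qed.
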